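(* Let $U\colon\mathcal{C}\to\mathcal{X}$ and $V\colon\mathcal{D}\to\mathcal{Y}$ be opfibrations and let $(K,F)\colon U\to V$ be an opfibred 1-cell, with $K\colon\mathcal{C}\to\mathcal{D}$ and $F\colon\mathcal{X}\to\mathcal{Y}$. Let $X\in\mathcal{X}$ be a coreflection of $Y\in\mathcal{Y}$ along $F$ with counit $\varepsilon\colon F(X)\to Y$. Then the following are equivalent for objects $C\in\mathcal{C}_X$ and $D\in\mathcal{D}_Y$: (1) $C$ is a coreflection of $D$ along $K$ with counit $e\colon K(C)\to D$ such that $Ve=\varepsilon$; (2) $C$ is a coreflection of $D$ along the functor $\mathcal{C}_X\xrightarrow{K}\mathcal{D}_{F(X)}\xrightarrow{\varepsilon_!}\mathcal{D}_Y$. In this case, $e=u\circ\tilde\varepsilon_C$, where $\tilde\varepsilon_C\colon K(C)\to\varepsilon_!K(C)$ is the cocartesian lifting of $\varepsilon$ at $K(C)$, and $e\colon K(C)\to D$ and $u\colon\varepsilon_!K(C)\to D$ are the counits of the respective coreflections.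
   Context: All opfibrations are cloven (equipped with chosen cocartesian liftings). The fibre of $U\colon\mathcal{C}\to\mathcal{X}$ over $X$, denoted $\mathcal{C}_X$, is the subcategory of morphisms sent by $U$ to $1_X$. For $f\colon Y'\to Y$ in the base of an opfibration $V\colon\mathcal{D}\to\mathcal{Y}$, $f_!\colon\mathcal{D}_{Y'}\to\mathcal{D}_Y$ denotes the reindexing functor sending an object to the codomain of the chosen cocartesian lifting of $f$ at it. An opfibred 1-cell $(K,F)\colon U\to V$ is a commutative square $VK=FU$ such that $K$ preserves cocartesian morphisms; $K$ then restricts to functors $\mathcal{C}_X\to\mathcal{D}_{F(X)}$. An object $A$ is a coreflection of an object $B$ along a functor $T$ with counit $e\colon T(A)\to B$ if $(A,e)$ represents the presheaf $\mathrm{Hom}(T-,B)$. *)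

(* Defs.v *)
From mathcomp Require Import ssreflect ssrfun ssrbool.
From Stdlib Require Import ProofIrrelevance IndefiniteDescription.

Set Implicit Arguments.
Unset Strict Implicit.
Unset Printing Implicit Defensive.

Declare Scope cat_scope.
Delimit Scope cat_scope with cat.
Local Open Scope cat_scope.

(** * Categories, functors, presheaves *)

Record category := Category {
  ob :> Type;
  hom : ob -> ob -> Type;
  idm : forall a, hom a a;
  compm : forall a b c, hom b c -> hom a b -> hom a c;
  comp1m : forall a b (f : hom a b), compm (idm b) f = f;
  compm1 : forall a b (f : hom a b), compm f (idm a) = f;
  compmA : forall a b c d (h : hom c d) (g : hom b c) (f : hom a b),
    compm h (compm g f) = compm (compm h g) f
}.

Arguments hom {_} a b.
Arguments idm {_} a.
Arguments compm {_ a b c} g f.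

Notation "g ∘ f" := (compm g f) (at level 40, left associativity) : cat_scope.

(** A morphism bundled with its endpoints.  [f ≡ g] says that [f] and [g] are
    the same morphism of the category, when their endpoints are equal but
    perhaps not convertible; it implies the equality of the endpoints. *)
Record arrow (A : category) := Arrow {
  dom : A;
  cod : A;
  arr : hom dom cod
}.

Arguments Arrow {A dom cod} arr.

Notation "f ≡ g" := (Arrow f = Arrow g) (at level 70, no associativity)
  : cat_scope.

Record functor (A B : category) := Functor {
  fob :> A -> B;
  fmap : forall a b, hom a b -> hom (fob a) (fob b);
  fmap1 : forall a, fmap (idm a) = idm (fob a);
  fmapM : forall a b c (g : hom b c) (f : hom a b),
    fmap (g ∘ f) = fmap g ∘ fmap f
}.

Arguments fmap {A B} F {a b} f : rename.

Definition fcomp_map (A B C : category) (G : functor B C) (F : functor A B)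
    (a b : A) (f : hom a b) : hom (G (F a)) (G (F b)) :=
  fmap G (fmap F f).

Lemma fcomp_map1 (A B C : category) (G : functor B C) (F : functor A B) (a : A) :
  fcomp_map G F (idm a) = idm (G (F a)).
Proof. by rewrite /fcomp_map !fmap1. Qed.

Lemma fcomp_mapM (A B C : category) (G : functor B C) (F : functor A B)
    (a b c : A) (g : hom b c) (f : hom a b) :
  fcomp_map G F (g ∘ f) = fcomp_map G F g ∘ fcomp_map G F f.
Proof. by rewrite /fcomp_map !fmapM. Qed.

Definition fcomp (A B C : category) (G : functor B C) (F : functor A B) :
    functor A C :=
  {| fob := fun a => G (F a);
     fmap := @fcomp_map A B C G F;
     fmap1 := @fcomp_map1 A B C G F;
     fmapM := @fcomp_mapM A B C G F |}.

(** Strict equality of functors; the equality on objects is included in [≡]. *)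
Definition functor_eq (A B : category) (G H : functor A B) : Prop :=
  forall (a b : A) (f : hom a b), fmap G f ≡ fmap H f.

Record presheaf (A : category) := Presheaf {
  pob :> A -> Type;
  pmap : forall a b, hom a b -> pob b -> pob a;
  pmap1 : forall a (x : pob a), pmap (idm a) x = x;
  pmapM : forall a b c (g : hom b c) (f : hom a b) (x : pob c),
    pmap (g ∘ f) x = pmap f (pmap g x)
}.

Arguments pmap {A} P {a b} f x : rename.

(** The natural transformation [Hom(-, a) -> P] determined by [x] through the
    Yoneda lemma is an isomorphism. *)
Definition represents (A : category) (P : presheaf A) (a : A) (x : P a) : Prop :=
  forall b : A, bijective (fun f : hom b a => pmap P f x).

Lemma hom_along1 (A B : category) (T : functor A B) (b : B) (a : A)
    (e : hom (T a) b) : e ∘ fmap T (idm a) = e.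
Proof. by rewrite fmap1 compm1. Qed.

Lemma hom_alongM (A B : category) (T : functor A B) (b : B) (a1 a2 a3 : A)
    (g : hom a2 a3) (f : hom a1 a2) (e : hom (T a3) b) :
  e ∘ fmap T (g ∘ f) = e ∘ fmap T g ∘ fmap T f.
Proof. by rewrite fmapM compmA. Qed.

(** The presheaf [Hom(T-, b)]. *)
Definition hom_along (A B : category) (T : functor A B) (b : B) : presheaf A :=
  {| pob := fun a => hom (T a) b;
     pmap := fun a1 a2 f e => e ∘ fmap T f;
     pmap1 := @hom_along1 A B T b;
     pmapM := @hom_alongM A B T b |}.

(** [a] is a coreflection of [b] along [T] with counit [e]. *)
Definition coreflection (A B : category) (T : functor A B) (a : A) (b : B)
    (e : hom (T a) b) : Prop :=
  represents (P := hom_along T b) e.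

Arguments coreflection {A B} T a b e.

(** * Fibres *)

Definition fibre_ob (C X : category) (U : functor C X) (x : X) : Type :=
  {c : C | U c = x}.

Definition fibre_hom (C X : category) (U : functor C X) (x : X)
    (c c' : fibre_ob U x) : Type :=
  {f : hom (sval c) (sval c') | fmap U f ≡ idm x}.

Section Arrows.

Variable A : category.

Lemma arrow_inj (a b : A) (f g : hom a b) : f ≡ g -> f = g.
Proof.
move=> fg; pose P (h : arrow A) := {p : dom h = a & {q : cod h = b |
  eq_rect _ (fun y => hom a y) (eq_rect _ (fun x => hom x (cod h)) (arr h) _ p)
    _ q = g}}.
have: P (Arrow f).
  by rewrite fg; exists (erefl _); exists (erefl _).
case=> /= p [q].
by rewrite (proof_irrelevance _ p (erefl _)) (proof_irrelevance _ q (erefl _)).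
Qed.

Lemma arrow_comp (a b c a' b' c' : A) (g : hom b c) (f : hom a b)
    (g' : hom b' c') (f' : hom a' b') :
  g ≡ g' -> f ≡ f' -> g ∘ f ≡ g' ∘ f'.
Proof.
move=> gg ff.
have eb : b = b' by exact: (f_equal (@dom A) gg).
have ec : c = c' by exact: (f_equal (@cod A) gg).
have ea : a = a' by exact: (f_equal (@dom A) ff).
by subst; rewrite (arrow_inj gg) (arrow_inj ff).
Qed.

Lemma arrow_idm (a b : A) : a = b -> idm a ≡ idm b.
Proof. by move->. Qed.

Lemma arrow_idl (a b c z : A) (h : hom b c) (f : hom a b) :
  h ≡ idm z -> h ∘ f ≡ f.
Proof.
move=> hz.
have eb : b = z by exact: (f_equal (@dom A) hz).
have ec : c = z by exact: (f_equal (@cod A) hz).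
by subst; rewrite (arrow_inj hz) comp1m.
Qed.

Lemma arrow_idr (a b c z : A) (g : hom b c) (h : hom a b) :
  h ≡ idm z -> g ∘ h ≡ g.
Proof.
move=> hz.
have eb : a = z by exact: (f_equal (@dom A) hz).
have ec : b = z by exact: (f_equal (@cod A) hz).
by subst; rewrite (arrow_inj hz) compm1.
Qed.

Lemma arrow_cast (a b z : A) : a = z -> b = z -> exists h : hom a b, h ≡ idm z.
Proof. by move=> -> ->; exists (idm z). Qed.

End Arrows.

Lemma functor_arrow (A B : category) (G : functor A B) (a b a' b' : A)
    (f : hom a b) (f' : hom a' b') : f ≡ f' -> fmap G f ≡ fmap G f'.
Proof.
exact: (f_equal (fun h : arrow A => Arrow (fmap G (arr h)))).
Qed.

Section Fibre.

Variables (C X : category) (U : functor C X) (x : X).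

Definition fibre_idm (c : fibre_ob U x) : fibre_hom c c.
Proof.
exists (idm (sval c)).
by rewrite fmap1; apply: arrow_idm; exact: (svalP c).
Defined.

Definition fibre_comp (a b c : fibre_ob U x) (g : fibre_hom b c)
    (f : fibre_hom a b) : fibre_hom a c.
Proof.
exists (sval g ∘ sval f).
by rewrite fmapM (arrow_idl _ (svalP g)); exact: (svalP f).
Defined.

Lemma fibre_hom_inj (a b : fibre_ob U x) (f g : fibre_hom a b) :
  sval f = sval g -> f = g.
Proof.
case: f g => f pf [g pg] /= fg; subst g.
by rewrite (proof_irrelevance _ pf pg).
Qed.

Lemma fibre_comp1m (a b : fibre_ob U x) (f : fibre_hom a b) :
  fibre_comp (fibre_idm b) f = f.
Proof. by apply: fibre_hom_inj; rewrite /= comp1m. Qed.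

Lemma fibre_compm1 (a b : fibre_ob U x) (f : fibre_hom a b) :
  fibre_comp f (fibre_idm a) = f.
Proof. by apply: fibre_hom_inj; rewrite /= compm1. Qed.

Lemma fibre_compA (a b c d : fibre_ob U x) (h : fibre_hom c d)
    (g : fibre_hom b c) (f : fibre_hom a b) :
  fibre_comp h (fibre_comp g f) = fibre_comp (fibre_comp h g) f.
Proof. by apply: fibre_hom_inj; rewrite /= compmA. Qed.

Definition fibre : category :=
  {| ob := fibre_ob U x;
     hom := @fibre_hom C X U x;
     idm := fibre_idm;
     compm := fibre_comp;
     comp1m := fibre_comp1m;
     compm1 := fibre_compm1;
     compmA := fibre_compA |}.

End Fibre.

(** * Cloven opfibrations *)

Definition cocartesian (C X : category) (U : functor C X) (c c' : C)
    (f : hom c c') : Prop :=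
  forall (c'' : C) (g : hom c c'') (h : hom (U c') (U c'')),
    h ∘ fmap U f = fmap U g ->
    exists! k : hom c' c'', fmap U k = h /\ k ∘ f = g.

Record opfibration (C X : category) := Opfibration {
  opfun :> functor C X;
  push : forall x' x : X, hom x' x -> fibre opfun x' -> fibre opfun x;
  lift : forall (x' x : X) (f : hom x' x) (c : fibre opfun x'),
    hom (sval c) (sval (push f c));
  lift_over : forall (x' x : X) (f : hom x' x) (c : fibre opfun x'),
    fmap opfun (lift f c) ≡ f;
  lift_cocartesian : forall (x' x : X) (f : hom x' x) (c : fibre opfun x'),
    cocartesian opfun (lift f c)
}.

Arguments push {C X} U {x' x} f c : rename.
Arguments lift {C X} U {x' x} f c : rename.
Arguments lift_over {C X} U {x' x} f c : rename.
Arguments lift_cocartesian {C X} U {x' x} f c : rename.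

Section Reindexing.

Variables (C X : category) (U : opfibration C X) (x' x : X) (f : hom x' x).

Lemma lift_factor (c : fibre U x') (d : fibre U x) (g : hom (sval c) (sval d)) :
  fmap U g ≡ f ->
  exists! k : hom (push U f c) d, sval k ∘ lift U f c = g.
Proof.
move=> gf.
have [h hx] := arrow_cast (svalP (push U f c)) (svalP d).
have hg : h ∘ fmap U (lift U f c) = fmap U g.
  by apply: arrow_inj; rewrite (arrow_idl _ hx) gf; exact: lift_over.
have [k [[kh kg] k_uniq]] := lift_cocartesian U f c _ _ _ hg.
have kx : fmap U k ≡ idm x by rewrite kh.
exists (exist _ k kx); split=> //= -[k' k'x] /= k'g.
apply: fibre_hom_inj => /=; apply: k_uniq; split=> //.
by apply: arrow_inj; rewrite k'x hx.
Qed.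

Lemma reindex_exists (c d : fibre U x') (k : hom c d) :
  exists l : hom (push U f c) (push U f d),
    sval l ∘ lift U f c = lift U f d ∘ sval k.
Proof.
have kf : fmap U (lift U f d ∘ sval k) ≡ f.
  by rewrite fmapM (arrow_idr _ (svalP k)); exact: lift_over.
by have [l [lk _]] := lift_factor kf; exists l.
Qed.

(** The morphism of the fibre over [x] induced by [k]; it is unique. *)
Definition reindex_map (c d : fibre U x') (k : hom c d) :
    hom (push U f c) (push U f d) :=
  sval (constructive_indefinite_description _ (reindex_exists k)).

Lemma reindex_mapE (c d : fibre U x') (k : hom c d) :
  sval (reindex_map k) ∘ lift U f c = lift U f d ∘ sval k.
Proof.
exact: (svalP (constructive_indefinite_description _ (reindex_exists k))).
Qed.

Lemma reindex_map_uniq (c d : fibre U x') (k : hom c d)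
    (l : hom (push U f c) (push U f d)) :
  sval l ∘ lift U f c = lift U f d ∘ sval k -> reindex_map k = l.
Proof.
move=> lk.
have kf : fmap U (lift U f d ∘ sval k) ≡ f.
  by rewrite fmapM (arrow_idr _ (svalP k)); exact: lift_over.
have [m [_ m_uniq]] := lift_factor kf.
by rewrite -(m_uniq _ lk); symmetry; apply: m_uniq; exact: reindex_mapE.
Qed.

Lemma reindex_map1 (c : fibre U x') : reindex_map (idm c) = idm (push U f c).
Proof. by apply: reindex_map_uniq; rewrite /= comp1m compm1. Qed.

Lemma reindex_mapM (a b c : fibre U x') (g : hom b c) (h : hom a b) :
  reindex_map (g ∘ h) = reindex_map g ∘ reindex_map h.
Proof.
apply: reindex_map_uniq => /=.
by rewrite -compmA reindex_mapE compmA reindex_mapE compmA.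
Qed.

(** The functor [f_!]. *)
Definition reindex : functor (fibre U x') (fibre U x) :=
  {| fob := push U f;
     fmap := reindex_map;
     fmap1 := reindex_map1;
     fmapM := reindex_mapM |}.

End Reindexing.

(** * Opfibred 1-cells *)

Record opfibred_1cell (C X D Y : category) (U : opfibration C X)
    (V : opfibration D Y) (K : functor C D) (F : functor X Y) : Prop :=
  Opfibred1Cell {
    opfibred_square : functor_eq (fcomp V K) (fcomp F U);
    opfibred_cocartesian : forall (c c' : C) (f : hom c c'),
      cocartesian U f -> cocartesian V (fmap K f)
  }.

Section Restriction.

Variables (C X D Y : category) (U : opfibration C X) (V : opfibration D Y).
Variables (K : functor C D) (F : functor X Y) (KF : opfibred_1cell U V K F).
Variable x : X.

Lemma restrict_over_ob (c : fibre U x) : V (K (sval c)) = F x.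
Proof.
apply: eq_trans (f_equal F (svalP c)).
exact: (f_equal (@dom Y) (opfibred_square KF (idm (sval c)))).
Qed.

Definition restrict_ob (c : fibre U x) : fibre V (F x) :=
  exist _ (K (sval c)) (restrict_over_ob c).

Lemma restrict_over_map (c c' : fibre U x) (f : hom c c') :
  fmap V (fmap K (sval f)) ≡ idm (F x).
Proof.
rewrite -fmap1 -(functor_arrow F (svalP f)).
exact: (opfibred_square KF (sval f)).
Qed.

Definition restrict_map (c c' : fibre U x) (f : hom c c') :
    hom (restrict_ob c) (restrict_ob c') :=
  exist _ (fmap K (sval f)) (restrict_over_map f).

Lemma restrict_map1 (c : fibre U x) :
  restrict_map (idm c) = idm (restrict_ob c).
Proof. by apply: fibre_hom_inj; rewrite /= fmap1. Qed.

Lemma restrict_mapM (a b c : fibre U x) (g : hom b c) (f : hom a b) :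
  restrict_map (g ∘ f) = restrict_map g ∘ restrict_map f.
Proof. by apply: fibre_hom_inj; rewrite /= fmapM. Qed.

(** The functor between the fibres over [x] and [F x] induced by [K]. *)
Definition restrict : functor (fibre U x) (fibre V (F x)) :=
  {| fob := restrict_ob;
     fmap := restrict_map;
     fmap1 := restrict_map1;
     fmapM := restrict_mapM |}.

End Restriction.

(* Main.v *)
Require Import Defs.
From mathcomp Require Import ssreflect ssrfun ssrbool.
From Stdlib Require Import IndefiniteDescription.

Local Open Scope cat_scope.

(** A morphism [e : K c -> d] over [eps] factors uniquely as [u ∘ epsC] with [u]
    in the fibre over [y], because [epsC] is cocartesian; so it is enough to
    show that [e] is a universal arrow from [K] to [d] if and only if [u] is a
    universal arrow from [T = eps_! K] to [d] (lemma [coreflection_total_fibre]).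
    The two are related by the equation [e ∘ K k = (u ∘ T k) ∘ epsA], valid for
    every [k : a -> c] in the fibre over [x], where [epsA] is the lifting of
    [eps] at [K a] (lemma [counit_restrict]).

    If [e] is universal, a morphism [T a -> d] of the fibre over [y] amounts to a
    morphism [K a -> d] over [eps], hence to some [f : a -> c] of the total
    category.  This [f] lies in the fibre over [x]: the morphisms [U f] and
    [id] become equal after application of [F] and composition with [eps], and
    [eps] is universal.

    If [u] is universal, let [g : K b -> d] be any morphism.  As [eps] is
    universal, [V g] is [eps ∘ F h] for a unique [h : U b -> x].  Let
    [l : b -> h_! b] be the lifting of [h].  Since [K] preserves cocartesian
    morphisms, the composite of [K l] and the lifting of [eps] is cocartesian
    over [eps ∘ F h], and so [g] amounts to a morphism [T (h_! b) -> d] of the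
    fibre, hence to a morphism [h_! b -> c] of the fibre, hence to a morphism
    [b -> c] over [h].  Any [f] with [e ∘ K f = g] is over [h], so this accounts
    for all of them. *)

Lemma arrow_recast {A : category} {a b a' b' : A} (f : hom a b) :
  a = a' -> b = b' -> exists f' : hom a' b', f' ≡ f.
Proof. by move=> <- <-; exists f. Qed.

Lemma image_to_base {C X : category} {U : functor C X} {c : C} {x : X}
    {cx : fibre U x} (f : hom c (sval cx)) :
  exists h : hom (U c) x, fmap U f ≡ h.
Proof.
have [h hf] := arrow_recast (fmap U f) (erefl (U c)) (svalP cx).
by exists h.
Qed.

(** Representability in the form in which it is checked and used: a universal
    arrow.  The inverse bijections come from unique choice. *)
Lemma coreflectionP {A B : category} {T : functor A B} {a : A} {b : B}
    {e : hom (T a) b} :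
  coreflection T a b e <->
  forall (a' : A) (g : hom (T a') b), exists! f : hom a' a, e ∘ fmap T f = g.
Proof.
split=> [e_rep a' g | e_univ a'].
  have [inv invK Kinv] := e_rep a'.
  exists (inv g); split; first exact: Kinv.
  by move=> f <-; exact: invK.
pose inv g := constructive_indefinite_description _ (e_univ a' g).
exists (fun g => sval (inv g)) => [f | g] /=.
  by case: (svalP (inv (e ∘ fmap T f))) => _; apply.
by case: (svalP (inv g)).
Qed.

Lemma coreflection_inj {A B : category} {T : functor A B} {a : A} {b : B}
    {e : hom (T a) b} (e_coref : coreflection T a b e) (a' : A) :
  injective (fun f : hom a' a => e ∘ fmap T f).
Proof. exact: bij_inj (e_coref a'). Qed.

Section Cocartesian.

Context {C X : category} {U : functor C X}.

Lemma cocartesian_comp {a b c : C} {f : hom a b} {g : hom b c} :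
  cocartesian U f -> cocartesian U g -> cocartesian U (g ∘ f).
Proof.
move=> f_coc g_coc z m h; rewrite fmapM compmA => hm.
have [k [[kh kf] k_uniq]] := f_coc _ _ _ hm.
have [l [[lh lg] l_uniq]] := g_coc _ _ _ (esym kh).
exists l; split; first by rewrite compmA lg.
move=> l' [l'h l'gf]; apply: l_uniq; split=> //.
by symmetry; apply: k_uniq; rewrite fmapM l'h -compmA.
Qed.

(** For an arbitrary cocartesian [f], so as to apply to the images of liftings
    under an opfibred 1-cell and to their composites with liftings, which need not belong to the cleavage. *)
Lemma cocartesian_vertical {x : X} {a : C} {b c : fibre U x}
    {f : hom a (sval b)} {g : hom a (sval c)} :
  cocartesian U f -> fmap U g ≡ fmap U f ->
  exists! k : hom b c, sval k ∘ f = g.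
Proof.
move=> f_coc gf.
have [h hx] := arrow_cast (svalP b) (svalP c).
have hg : h ∘ fmap U f = fmap U g.
  by apply: arrow_inj; rewrite (arrow_idl _ hx).
have [k [[kh kg] k_uniq]] := f_coc _ _ _ hg.
have kx : fmap U k ≡ idm x by rewrite kh.
exists (exist _ k kx); split=> //= -[k' k'x] /= k'g.
apply: fibre_hom_inj => /=; apply: k_uniq; split=> //.
by apply: arrow_inj; rewrite k'x hx.
Qed.

End Cocartesian.

Section Comparison.

Context {C X D Y : category} {U : opfibration C X} {V : opfibration D Y}.
Context {K : functor C D} {F : functor X Y} (KF : opfibred_1cell U V K F).
Context {x : X} {y : Y} {eps : hom (F x) y}.
Hypothesis eps_coref : coreflection F x y eps.
Context {c : fibre U x} {d : fibre V y}.

Let T := fcomp (reindex V eps) (restrict KF x).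
Let epsL (a : fibre U x) := lift V eps (restrict KF x a).

Variable u : hom (T c) d.

Let e : hom (K (sval c)) (sval d) := sval u ∘ epsL c.

Lemma counit_over : fmap V e ≡ eps.
Proof.
rewrite fmapM (arrow_idl _ (svalP u)).
exact: (lift_over V eps (restrict KF x c)).
Qed.

Lemma counit_restrict (a : fibre U x) (k : hom a c) :
  e ∘ fmap K (sval k) = sval (u ∘ fmap T k) ∘ epsL a.
Proof.
have := reindex_mapE (U := V) eps (fmap (restrict KF x) k).
by rewrite /e /= -!compmA /fcomp_map /epsL => ->.
Qed.

Lemma counit_comp_over {b : C} {f : hom b (sval c)} {h : hom (U b) x} :
  fmap U f ≡ h -> fmap V (e ∘ fmap K f) ≡ eps ∘ fmap F h.
Proof.
move=> fh; rewrite fmapM; apply: arrow_comp; first exact: counit_over.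
rewrite -(functor_arrow F fh); exact: (opfibred_square KF f).
Qed.

Lemma fibre_coreflection_of_total :
  coreflection K (sval c) (sval d) e -> coreflection T c d u.
Proof.
move=> e_coref; apply/coreflectionP => a g.
have [f [fg f_uniq]] :=
  proj1 coreflectionP e_coref _ (sval g ∘ epsL a).
have fx : fmap U f ≡ idm x.
  have [h fh] := image_to_base f.
  have [i ix] := arrow_cast (svalP a) (erefl x).
  (* [h] and [i] are the morphisms [U f] and [id] between the same endpoints. *)
  rewrite fh -ix; congr Arrow; apply: (coreflection_inj eps_coref).
  apply: arrow_inj; rewrite -(counit_comp_over fh) fg fmapM.
  rewrite (arrow_idl _ (svalP g)) (lift_over V eps (restrict KF x a)).
  have Fi : fmap F i ≡ idm (F x) by rewrite (functor_arrow F ix) fmap1.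
  by rewrite (arrow_idr _ Fi).
(* Precomposition with the cocartesian [epsL a] is injective on vertical maps. *)
have T_determined (k : hom a c) :
    u ∘ fmap T k = g <-> e ∘ fmap K (sval k) = sval g ∘ epsL a.
  rewrite counit_restrict; split=> [-> // | kg].
  have gV : fmap V (sval g ∘ epsL a) ≡ fmap V (epsL a).
    by rewrite fmapM (arrow_idl _ (svalP g)).
  have [m [_ m_uniq]] :=
    cocartesian_vertical (lift_cocartesian V eps (restrict KF x a)) gV.
  by rewrite -(m_uniq _ kg); exact: m_uniq.
exists (exist _ f fx); split; first exact/T_determined.
by move=> k /T_determined kg; apply: fibre_hom_inj; exact: f_uniq.
Qed.

Lemma total_coreflection_of_fibre :
  coreflection T c d u -> coreflection K (sval c) (sval d) e.
Proof.
move=> u_coref; apply/coreflectionP => b g.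
have Vb : V (K b) = F (U b).
  exact: (f_equal (@dom Y) (opfibred_square KF (idm b))).
(* [g0] is [V g], with endpoints replaced so that [eps] can be applied to it. *)
have [g0 g0E] := arrow_recast (fmap V g) Vb (svalP d).
have [h [hg0 h_uniq]] := proj1 coreflectionP eps_coref _ g0.
pose b0 : fibre U (U b) := exist _ b (erefl _).
pose a := push U h b0.
pose l : hom b (sval a) := lift U h b0.
have Kl_coc : cocartesian V (fmap K l).
  by apply: (opfibred_cocartesian KF); exact: (lift_cocartesian U h b0).
have m_coc : cocartesian V (epsL a ∘ fmap K l).
  exact: cocartesian_comp Kl_coc (lift_cocartesian V eps (restrict KF x a)).
have m_over : fmap V g ≡ fmap V (epsL a ∘ fmap K l).
  rewrite -g0E -hg0 fmapM; symmetry; apply: arrow_comp.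
    exact: (lift_over V eps (restrict KF x a)).
  rewrite -(functor_arrow F (lift_over U h b0)); exact: (opfibred_square KF l).
have [v [vg v_uniq]] := cocartesian_vertical m_coc m_over.
have [k [kv k_uniq]] := proj1 coreflectionP u_coref _ v.
have transpose (k' : hom a c) :
    e ∘ fmap K (sval k' ∘ l) = sval (u ∘ fmap T k') ∘ (epsL a ∘ fmap K l).
  by rewrite fmapM !compmA counit_restrict.
exists (sval k ∘ l); split; first by rewrite transpose kv.
move=> f fg.
(* [V g] determines [U f], because [eps] is universal. *)
have fh : fmap U f ≡ fmap U l.
  have [h' fh'] := image_to_base f.
  rewrite fh' (lift_over U h b0) (h_uniq h') //.
  by apply: arrow_inj; rewrite g0E -fg (counit_comp_over fh').
have [k' [k'f _]] := cocartesian_vertical (lift_cocartesian U h b0) fh.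
rewrite -k'f; congr (sval _ ∘ _); apply: k_uniq.
by symmetry; apply: v_uniq; rewrite -transpose k'f.
Qed.

Lemma coreflection_total_fibre :
  coreflection K (sval c) (sval d) e <-> coreflection T c d u.
Proof.
by split; [exact: fibre_coreflection_of_total
          | exact: total_coreflection_of_fibre].
Qed.

End Comparison.

Theorem theorem3p3 (C X D Y : category)
    (U : opfibration C X) (V : opfibration D Y)
    (K : functor C D) (F : functor X Y) (KF : opfibred_1cell U V K F)
    (x : X) (y : Y) (eps : hom (F x) y) (eps_coref : coreflection F x y eps)
    (c : fibre U x) (d : fibre V y) :
  let T := fcomp (reindex V eps) (restrict KF x) in
  let epsC := lift V eps (restrict KF x c) in
  let total_counit (e : hom (K (sval c)) (sval d)) :=
    coreflection K (sval c) (sval d) e /\ fmap V e ≡ eps in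
  let fibre_counit (u : hom (T c) d) := coreflection T c d u in
  ((exists e, total_counit e) <-> (exists u, fibre_counit u)) /\
  (forall e, total_counit e -> exists u, fibre_counit u /\ e = sval u ∘ epsC) /\
  (forall u, fibre_counit u -> exists e, total_counit e /\ e = sval u ∘ epsC).
Proof.
move=> T epsC total_counit fibre_counit.
have to_fibre e : total_counit e -> exists u, fibre_counit u /\ e = sval u ∘ epsC.
  case=> e_coref e_eps.
  have [u [ue _]] := lift_factor (c := restrict KF x c) e_eps.
  exists u; split; last by rewrite ue.
  by apply/(coreflection_total_fibre KF eps_coref);
     rewrite ue.
have to_total u : fibre_counit u -> exists e, total_counit e /\ e = sval u ∘ epsC.
  move=> u_coref; exists (sval u ∘ epsC); split=> //; split.
    exact/(coreflection_total_fibre KF eps_coref).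
  exact: counit_over.
split=> //; split=> [[e /to_fibre[u [u_counit _]]] | [u /to_total[e [e_counit _]]]].
  by exists u.
by exists e.
Qed.
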